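(* Closure under unknown information is decidable on languages accepted by c-automata: there is an algorithm that, given a c-automaton $\mathcal{A}$, decides whether $\mathbf{L}(\mathcal{A})$ is CUI.
   Context: Fix disjoint sets $\mathfrak{P}$ (participants) and $\mathfrak{M}$ (messages); interactions $\Sigma_{int}=\{A\to B{:}m\mid A\neq B\}$. An FSA $\langle\mathcal{S},q_0,\mathcal{L},\to\rangle$ has finitely many states, initial state, finitely many labels and transitions; all states are accepting and its language $\mathbf{L}$ consists of finite words labelling finite paths from $q_0$ and infinite words labelling infinite paths from $q_0$. A c-automaton is a deterministic FSA labelled in $\Sigma_{int}$. Projection: $(A\to B{:}m){\upharpoonright}_A=AB!m$, $(A\to B{:}m){\upharpoonright}_B=AB?m$, $\varepsilon$ for other participants, extended homomorphically to words. A set $\mathcal{L}$ of interaction words is CUI (closed under unknown information) if for all finite words $w_1\cdot\alpha,w_2\cdot\alpha\in\mathcal{L}$ with the same last interaction $\alpha=A\to B{:}m$ and all $w\in\mathcal{L}$ with $w{\upharpoonright}_A=w_1{\upharpoonright}_A$ and $w{\upharpoonright}_B=w_2{\upharpoonright}_B$, we have $w\cdot\alpha\in\mathcal{L}$. *)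

(* Defs.v *)
From HB Require Import structures.
From mathcomp Require Import all_boot.

Set Implicit Arguments.
Unset Strict Implicit.
Unset Printing Implicit Defensive.

(* Kleene's mu-recursive functions; [recfun n] is a program with n inputs. *)
Inductive recfun : nat -> Type :=
| RZero n : recfun n
| RSucc : recfun 1
| RProj n (i : 'I_n) : recfun n
| RComp n m (f : recfun m) (g : 'I_m -> recfun n) : recfun n
| RRec n (f : recfun n) (g : recfun n.+2) : recfun n.+1
| RMin n (f : recfun n.+1) : recfun n.

(* [computes f v y]: the program f halts on the input v with output y.
   In the case of primitive recursion on the first argument x, the values
   r 0, ..., r x are those of the function on 0, ..., x; minimization is
   over the first argument. *)
Fixpoint computes n (f : recfun n) : n.-tuple nat -> nat -> Prop :=
  match f in recfun n return n.-tuple nat -> nat -> Prop with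
  | RZero _ => fun _ y => y = 0
  | RSucc => fun v y => y = (thead v).+1
  | RProj _ i => fun v y => y = tnth v i
  | RComp _ m f g => fun v y =>
      exists2 w : m.-tuple nat,
        forall i, computes (g i) v (tnth w i) & computes f w y
  | RRec _ f g => fun v y =>
      let x := thead v in
      let u := [tuple of behead v] in
      exists r : nat -> nat,
        [/\ computes f u (r 0),
            forall k, k < x -> computes g [tuple of k :: r k :: u] (r k.+1)
          & y = r x]
  | RMin _ f => fun v y =>
      computes f [tuple of y :: v] 0 /\
      forall k, k < y -> exists z, computes f [tuple of k :: v] z.+1
  end.

Lemma computes_fun n (f : recfun n) v y y' :
  computes f v y -> computes f v y' -> y = y'.
Proof.
elim: f v y y' => {n} [n||n i|n m f IHf g IHg|n f IHf g IHg|n f IHf] v y y' /=.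
- by move=> -> ->.
- by move=> -> ->.
- by move=> -> ->.
- move=> [w gw fw] [w' gw' fw'].
  suff eww' : w = w' by subst w'; apply: IHf fw fw'.
  by apply: eq_from_tnth => i; apply: IHg (gw i) (gw' i).
- move=> [r [r0 rS ->]] [r' [r0' rS' ->]].
  have: thead v <= thead v by [].
  elim: {1 3 4}(thead v) => [_|k IHk ltkx]; first exact: IHf r0 r0'.
  have := rS' k ltkx; rewrite -(IHk (ltnW ltkx)).
  exact: IHg (rS k ltkx).
- move=> [fy lty] [fy' lty']; case: (ltngtP y y') => // lt_y.
  + by have [z fz] := lty' _ lt_y; have := IHf _ _ _ fy fz.
  + by have [z fz] := lty _ lt_y; have := IHf _ _ _ fy' fz.
Qed.

Inductive word (T : Type) : Type :=
| Fin of seq T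
| Inf of (nat -> T).

(* Concatenation with one letter; an infinite word absorbs what follows it. *)
Definition word_rcons (T : Type) (w : word T) (a : T) : word T :=
  match w with
  | Fin s => Fin (rcons s a)
  | Inf f => Inf f
  end.

(* All states are accepting. *)
Record fsa (L : eqType) := Fsa {
  state : finType;
  init : state;
  labels : seq L;
  trans : seq (state * L * state);
  trans_labels : all (fun t => t.1.2 \in labels) trans
}.

Definition deterministic (L : eqType) (A : fsa L) : Prop :=
  forall (q : state A) (l : L) (q1 q2 : state A),
    (q, l, q1) \in trans A -> (q, l, q2) \in trans A -> q1 = q2.

Fixpoint finite_path (L : eqType) (A : fsa L) (q : state A) (s : seq L) : Prop :=
  match s with
  | [::] => True
  | l :: s' => exists2 q', (q, l, q') \in trans A & finite_path q' s'
  end.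

Definition infinite_path (L : eqType) (A : fsa L) (q : state A)
    (f : nat -> L) : Prop :=
  exists2 r : nat -> state A,
    r 0 = q & forall n, (r n, f n, r n.+1) \in trans A.

Definition lang (L : eqType) (A : fsa L) (w : word L) : Prop :=
  match w with
  | Fin s => finite_path (init A) s
  | Inf f => infinite_path (init A) f
  end.

Section Interactions.
Variables P M : eqType.

Record interaction := Interaction {
  int_val : P * P * M;
  int_valP : int_val.1.1 != int_val.1.2
}.

HB.instance Definition _ := [isSub for int_val].
HB.instance Definition _ := [Equality of interaction by <:].

Definition sender (a : interaction) : P := (int_val a).1.1.
Definition receiver (a : interaction) : P := (int_val a).1.2.
Definition message (a : interaction) : M := (int_val a).2.

Inductive action :=
| Send of P & P & M
| Recv of P & P & M.

(* [None] stands for the empty word. *)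
Definition proj_letter (X : P) (a : interaction) : option action :=
  if X == sender a then Some (Send (sender a) (receiver a) (message a))
  else if X == receiver a then Some (Recv (sender a) (receiver a) (message a))
  else None.

Definition proj (X : P) (s : seq interaction) : seq action := pmap (proj_letter X) s.

(* [proj_is X w u]: the projection of w on X is the finite word u.  An infinite
   word has a finite projection when X takes part in none of its interactions
   from some position on. *)
Definition proj_is (X : P) (w : word interaction) (u : seq action) : Prop :=
  match w with
  | Fin s => proj X s = u
  | Inf f => exists2 N, forall n, N <= n -> proj_letter X (f n) = None
                      & proj X (mkseq f N) = u
  end.

Definition CUI (K : word interaction -> Prop) : Prop :=
  forall (w1 w2 : seq interaction) (a : interaction),
    K (Fin (rcons w1 a)) -> K (Fin (rcons w2 a)) ->
  forall w : word interaction, K w ->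
    proj_is (sender a) w (proj (sender a) w1) ->
    proj_is (receiver a) w (proj (receiver a) w2) ->
    K (word_rcons w a).

Definition participants (A : fsa interaction) : seq P :=
  map sender (labels A) ++ map receiver (labels A).

Definition messages (A : fsa interaction) : seq M := map message (labels A).

(* Numbers presenting automata to programs: states are numbered by
   [enum_rank], participants and messages by nP and nM, and lists of numbers
   are encoded by the bijection [CodeSeq.code] of [seq nat] with [nat]. *)
Section Encoding.
Variables (nP : P -> nat) (nM : M -> nat).

Definition code_interaction (a : interaction) : nat :=
  CodeSeq.code [:: nP (sender a); nP (receiver a); nM (message a)].

Definition code_state (S : finType) (q : S) : nat := enum_rank q.

Definition code_trans (S : finType) (t : S * interaction * S) : nat :=
  CodeSeq.code [:: code_state t.1.1; code_interaction t.1.2; code_state t.2].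

Definition code_fsa (A : fsa interaction) : nat :=
  CodeSeq.code [:: #|state A|; code_state (init A);
    CodeSeq.code (map code_interaction (labels A));
    CodeSeq.code (map (@code_trans (state A)) (trans A))].

End Encoding.

End Interactions.

(* On input x, the program f halts and answers (1 or 0) whether Q holds. *)
Definition answers (f : recfun 1) (x : nat) (Q : Prop) : Prop :=
  exists b : bool, computes f [tuple x] b /\ (b <-> Q).

(* Main.v *)
(* Since A is deterministic, its language fails to be CUI exactly when there are
   an interaction a = X -> Y: m and finite words w, w1, w2 labelling runs from
   the initial state to states q, p1, p2, with w and w1 equal on X and w and w2
   equal on Y, such that a is enabled in p1 and p2 but not in q (an infinite w
   absorbs a).  Such triples (q, p1, p2) are those reachable in a product of
   three copies of A in which the first two synchronise on the interactions
   involving X, and the first and third on those involving Y.  This graph has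
   N ^ 3 vertices, N being the number of states, so reachability is the
   existence of a path with N ^ 3 steps (steps may be idle), a bounded
   quantification over arithmetical codes of paths, hence primitive recursive. *)
Require Import Defs.
From mathcomp Require Import all_boot.

Set Implicit Arguments.
Unset Strict Implicit.
Unset Printing Implicit Defensive.

(** * Closure properties of computable functions *)

(* Functions of an environment [v], whose first [n] variables are the inputs of
   the program and whose other variables are 0. *)
Definition computable (F : (nat -> nat) -> nat) : Prop :=
  forall n, exists f : recfun n, forall t : n.-tuple nat, computes f t (F (nth 0 t)).

Lemma computable_ext F G : F =1 G -> computable F -> computable G.
Proof. by move=> eFG cF n; have [f fP] := cF n; exists f => t; rewrite -eFG. Qed.

Lemma computable_var k : computable (fun v => v k).
Proof.
move=> n; case: (ltnP k n) => [lt_kn | le_nk].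
  by exists (RProj (Ordinal lt_kn)) => t /=; rewrite (tnth_nth 0).
by exists (RZero n) => t /=; rewrite nth_default ?size_tuple.
Qed.

Lemma computable_succ F : computable F -> computable (fun v => (F v).+1).
Proof.
move=> cF n; have [f fP] := cF n; exists (RComp RSucc (fun=> f)) => t /=.
by exists [tuple F (nth 0 t)] => // i; rewrite (tnth_nth 0) ord1; apply: fP.
Qed.

Lemma computable_const c : computable (fun=> c).
Proof.
elim: c => [|c]; last exact: computable_succ.
by move=> n; exists (RZero n).
Qed.

(** Reduces a binary operation to the variables 0 and 1, so that the step of a recursion defining it
    does not mention [F] and [G], whose programs expect unshifted inputs. *)
Lemma computable_comp h F G :
  computable (fun v => h (v 0) (v 1)) -> computable F -> computable G ->
  computable (fun v => h (F v) (G v)).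
Proof.
move=> ch cF cG n; have [e eP] := ch 2; have [f fP] := cF n; have [g gP] := cG n.
exists (RComp e (fun i : 'I_2 => if i == ord0 then f else g)) => t /=.
exists [tuple F (nth 0 t); G (nth 0 t)]; last exact: eP.
by case=> [[|[|i]] lti].
Qed.

Lemma computable_rec F B G :
  computable F -> computable B ->
  computable (fun v => G (v 0) (v 1) (fun k => v k.+2)) ->
  computable (fun v => nat_rect (fun=> nat) (B v) (fun k r => G k r v) (F v)).
Proof.
move=> cF cB cG n; have [f fP] := cF n; have [b bP] := cB n; have [g gP] := cG n.+2.
(* The value of [F] is put in front of the inputs, as the bound of the recursion. *)
exists (RComp (RRec b g)
  (fun i : 'I_n.+1 => if unlift ord0 i is Some j then RProj j else f)) => t /=.
exists [tuple of F (nth 0 t) :: t].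
  move=> i; case: unliftP => [j ->|->] /=; last by rewrite tnth0; apply: fP.
  by rewrite tnthS.
rewrite theadE.
exists (nat_rect (fun=> nat) (B (nth 0 t)) (fun k r => G k r (nth 0 t))).
by split=> [|k _|]; [apply: bP | apply: gP |].
Qed.

Lemma computable_comp1 h F :
  computable (fun v => h (v 0)) -> computable F -> computable (fun v => h (F v)).
Proof. by move=> ch cF; apply: (@computable_comp (fun x _ => h x) F F). Qed.

Lemma computable_add F G :
  computable F -> computable G -> computable (fun v => F v + G v).
Proof.
move=> cF cG; apply: computable_ext (@computable_rec G F (fun _ r _ => r.+1) cG cF _).
  by move=> v; elim: (G v) => [|k IHk] /=; rewrite ?addn0 // IHk addnS.
exact/computable_succ/computable_var.
Qed.

Lemma computable_mul F G :
  computable F -> computable G -> computable (fun v => F v * G v).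
Proof.
apply: computable_comp; apply: computable_ext
  (@computable_rec (fun v => v 0) (fun=> 0) (fun _ r v => r + v 1) _ _ _).
- by move=> v; elim: (v 0) => [|k IHk] //=; rewrite IHk mulSn addnC.
- exact: computable_var.
- exact: computable_const.
- by apply: computable_add; apply: computable_var.
Qed.

Lemma computable_pred F : computable F -> computable (fun v => (F v).-1).
Proof.
move=> cF; apply: computable_ext
  (@computable_rec F (fun=> 0) (fun k _ _ => k) cF _ _).
- by move=> v; case: (F v).
- exact: computable_const.
- exact: computable_var.
Qed.

Lemma computable_sub F G :
  computable F -> computable G -> computable (fun v => F v - G v).
Proof.
move=> cF cG; apply: computable_ext (@computable_rec G F (fun _ r _ => r.-1) cG cF _).
  by move=> v; elim: (G v) => [|k IHk] /=; rewrite ?subn0 // IHk subnS.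
exact/computable_pred/computable_var.
Qed.

Lemma computable_exp F G :
  computable F -> computable G -> computable (fun v => F v ^ G v).
Proof.
apply: computable_comp; apply: computable_ext
  (@computable_rec (fun v => v 1) (fun=> 1) (fun _ r v => r * v 0) _ _ _).
- by move=> v; elim: (v 1) => [|k IHk] //=; rewrite IHk expnSr.
- exact: computable_var.
- exact: computable_const.
- by apply: computable_mul; apply: computable_var.
Qed.

Lemma computable_neg (b : (nat -> nat) -> bool) :
  computable b -> computable (fun v => ~~ b v).
Proof.
move=> cb; apply: computable_ext (computable_sub (computable_const 1) cb).
by move=> v; case: (b v).
Qed.

Lemma computable_and (b c : (nat -> nat) -> bool) :
  computable b -> computable c -> computable (fun v => b v && c v).
Proof.
move=> cb cc; apply: computable_ext (computable_mul cb cc).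
by move=> v; rewrite mulnb.
Qed.

Lemma computable_or (b c : (nat -> nat) -> bool) :
  computable b -> computable c -> computable (fun v => b v || c v).
Proof.
move=> cb cc.
apply: computable_ext
  (computable_neg (computable_and (computable_neg cb) (computable_neg cc))).
by move=> v; rewrite -negb_or negbK.
Qed.

Lemma computable_imp (b c : (nat -> nat) -> bool) :
  computable b -> computable c -> computable (fun v => b v ==> c v).
Proof.
move=> cb cc; apply: computable_ext (computable_or (computable_neg cb) cc).
by move=> v; rewrite implybE.
Qed.

Lemma computable_leq F G :
  computable F -> computable G -> computable (fun v => F v <= G v).
Proof.
move=> cF cG.
apply: computable_ext (computable_sub (computable_const 1) (computable_sub cF cG)).
by move=> v; rewrite /leq; case: (F v - G v).
Qed.

Lemma computable_eq F G :
  computable F -> computable G -> computable (fun v => F v == G v).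
Proof.
move=> cF cG.
apply: computable_ext (computable_and (computable_leq cF cG) (computable_leq cG cF)).
by move=> v; rewrite -eqn_leq.
Qed.

(** Built on programs directly: the recursion step receives the index, the partial sum and the
    inputs, while the summand expects the index and the inputs only, so [skip] leaves out position
    1. *)
Lemma computable_sum F G :
  computable F -> computable (fun v => G (v 0) (fun k => v k.+1)) ->
  computable (fun v => \sum_(0 <= i < F v) G i v).
Proof.
move=> cF cG n.
have [f fP] := cF n; have [g gP] := cG n.+1.
have [a aP] := computable_add (computable_var 0) (computable_var 1) 2.
pose skip (i : 'I_n.+1) : recfun n.+2 := RProj (lift (inord 1) i).
pose step := RComp a (fun i : 'I_2 =>
  if i == ord0 then RProj (inord 1) else RComp g skip).
exists (RComp (RRec (RZero n) step)
  (fun i : 'I_n.+1 => if unlift ord0 i is Some j then RProj j else f)) => t /=.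
exists [tuple of F (nth 0 t) :: t].
  move=> i; case: unliftP => [j ->|->] /=; last by rewrite tnth0; apply: fP.
  by rewrite tnthS.
rewrite theadE; exists (fun m => \sum_(0 <= i < m) G i (nth 0 t)).
split=> [|k _|//]; first by rewrite big_nil.
exists [tuple \sum_(0 <= i < k) G i (nth 0 t); G k (nth 0 t)].
  case=> [[|[|i]] lti] //; rewrite (tnth_nth 0) /=.
    by rewrite (tnth_nth 0) inordK.
  exists [tuple of k :: t]; last exact: gP.
  move=> i; rewrite !(tnth_nth 0) /= inordK //.
  by case: i => [[|i]].
by rewrite big_nat_recr //; apply: aP.
Qed.

(** * Bounded quantifiers, division and valuations *)

Definition bounded_ex n (Q : nat -> bool) := has Q (iota 0 n).

Definition bounded_all n (Q : nat -> bool) := all Q (iota 0 n).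

Lemma bounded_exP n (Q : nat -> bool) :
  reflect (exists2 i, i < n & Q i) (bounded_ex n Q).
Proof.
by apply: (iffP hasP) => -[i lti Qi]; exists i => //; rewrite mem_iota in lti *.
Qed.

Lemma bounded_allP n (Q : nat -> bool) :
  reflect (forall i, i < n -> Q i) (bounded_all n Q).
Proof.
by apply: (iffP allP) => allQ i lti; apply: allQ; rewrite mem_iota in lti *.
Qed.

(** A witness exists when the sum of the truth values is at least 1. *)
Lemma computable_bounded_ex F (Q : nat -> (nat -> nat) -> bool) :
  computable F -> computable (fun v => Q (v 0) (fun k => v k.+1)) ->
  computable (fun v => bounded_ex (F v) (fun i => Q i v)).
Proof.
move=> cF cQ.
apply: computable_ext
  (computable_leq (computable_const 1) (@computable_sum F (fun i v => Q i v) cF cQ)).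
move=> v /=; rewrite /bounded_ex has_count -sum1_count /index_iota subn0.
by rewrite [in RHS]big_mkcond.
Qed.

Lemma computable_bounded_all F (Q : nat -> (nat -> nat) -> bool) :
  computable F -> computable (fun v => Q (v 0) (fun k => v k.+1)) ->
  computable (fun v => bounded_all (F v) (fun i => Q i v)).
Proof.
move=> cF cQ; have cNQ := computable_neg cQ.
apply: computable_ext
  (computable_neg (@computable_bounded_ex F (fun i v => ~~ Q i v) cF cNQ)).
by move=> v /=; rewrite /bounded_ex has_predC negbK.
Qed.

(** The quotient of [x] by [y > 0] counts the [i < x] with [i.+1 * y <= x]; the guard [1 <= y] gives
    the conventional value 0 when [y = 0]. *)
Lemma computable_div F G :
  computable F -> computable G -> computable (fun v => F v %/ G v).
Proof.
apply: computable_comp; apply: computable_ext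
  (@computable_sum (fun v => v 0) (fun i v => (1 <= v 1) && (i.+1 * v 1 <= v 0)) _ _).
- move=> v; case: (posnP (v 1)) => [->|v1_gt0]; first by rewrite divn0 big1.
  transitivity (\sum_(0 <= i < v 0) (i < v 0 %/ v 1)).
    by apply: eq_bigr => i _; rewrite leq_divRL // v1_gt0.
  (* With the quotient generalized to [j <= m], exactly [j] of the numbers below [m] are below
     [j]. *)
  elim: (v 0) (_ %/ _) (leq_div (v 0) (v 1)) => [|m IHm] j.
    by rewrite leqn0 => /eqP->; rewrite big_nil.
  rewrite leq_eqVlt ltnS => /orP[/eqP->|le_jm]; rewrite big_nat_recr //=.
    rewrite ltnSn addn1 -[in RHS](IHm m) //; congr _.+1.
    by apply: eq_big_nat => i /andP[_ lt_im]; rewrite lt_im ltnW.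
  by rewrite IHm // ltnNge le_jm addn0.
- exact: computable_var.
- apply: computable_and; apply: computable_leq; first exact: computable_const.
  + exact: computable_var.
  + by apply: computable_mul; [apply: computable_succ|]; apply: computable_var.
  + exact: computable_var.
Qed.

Lemma computable_mod F G :
  computable F -> computable G -> computable (fun v => F v %% G v).
Proof.
move=> cF cG; apply: computable_ext
  (computable_sub cF (computable_mul (computable_div cF cG) cG)).
by move=> v; rewrite {1}(divn_eq (F v) (G v)) addKn.
Qed.

(** The valuation of [x] counts the exponents [e] with [1 <= e < x] such that [p ^ e] divides [x];
    writing [e = i.+1] gives the bound [x.-1]. *)
Lemma computable_logn p F : prime p -> computable F -> computable (fun v => logn p (F v)).
Proof.
move=> p_pr; apply: (@computable_comp1 (logn p)); apply: computable_ext
  (@computable_sum (fun v => (v 0).-1) (fun i v => v 0 %% p ^ i.+1 == 0) _ _).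
- by move=> v; rewrite logn_count_dvd // big_add1.
- exact/computable_pred/computable_var.
- apply: computable_eq; last exact: computable_const.
  apply: computable_mod; first exact: computable_var.
  apply: computable_exp; first exact: computable_const.
  exact/computable_succ/computable_var.
Qed.

(** * Arithmetical decoding of lists *)

Lemma logn2_code n s : logn 2 (CodeSeq.code (n :: s)) = n.
Proof.
(* The code of [n :: s] is [2 ^ n] times an odd number. *)
rewrite /= lognM ?expn_gt0 // pfactorK // lognE /= -[_.*2.+1]addn1 -mul2n.
by rewrite dvdn_addr ?dvdn_mulr //= addn0.
Qed.

(** Dividing by the power of 2 removes the head, and the odd cofactor is one more than twice the
    code of the tail. The empty list has code 0, which truncated arithmetic sends to 0. *)
Lemma code_behead s :
  CodeSeq.code (behead s) = (CodeSeq.code s %/ 2 ^ logn 2 (CodeSeq.code s)).-1 %/ 2.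
Proof.
case: s => [|n s]; first by rewrite logn0.
by rewrite logn2_code /= mulKn ?expn_gt0 //= -muln2 mulnK.
Qed.

Definition code_drop i c := CodeSeq.code (drop i (CodeSeq.decode c)).

Lemma computable_code_drop F G :
  computable F -> computable G -> computable (fun v => code_drop (F v) (G v)).
Proof.
move=> cF cG; apply: computable_ext
  (@computable_rec F G (fun _ r _ => (r %/ 2 ^ logn 2 r).-1 %/ 2) cF cG _).
  move=> v; elim: (F v) => [|i IHi] /=; first by rewrite /code_drop drop0 CodeSeq.decodeK.
  by rewrite IHi -code_behead -drop1 drop_drop.
have c1 := computable_var 1.
apply: computable_div (computable_pred (computable_div c1 _)) (computable_const 2).
exact: computable_exp (computable_const 2) (@computable_logn 2 _ isT c1).
Qed.

(** Past the end of the list the remaining code is 0, whose valuation 0 agrees with the default of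
    [nth]. *)
Lemma nth_code_drop i c : nth 0 (CodeSeq.decode c) i = logn 2 (code_drop i c).
Proof.
rewrite /code_drop -[i in LHS]addn0 -nth_drop; case: (drop i _) => [|n s].
  by rewrite nth_nil logn0.
by rewrite logn2_code.
Qed.

Lemma computable_nth_decode F G : computable F -> computable G ->
  computable (fun v => nth 0 (CodeSeq.decode (F v)) (G v)).
Proof.
move=> cF cG; apply: computable_ext
  (@computable_logn 2 _ isT (computable_code_drop cG cF)) => v.
by rewrite -nth_code_drop.
Qed.

(** Bounds the search for a position in a coded list. *)
Lemma size_decode c : size (CodeSeq.decode c) <= c.
Proof.
rewrite -[in leqRHS](CodeSeq.decodeK c); elim: (CodeSeq.decode c) => //= n s IHs.
rewrite -[_.+1]mul1n leq_mul ?expn_gt0 // ltnS (leq_trans IHs) //.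
by rewrite -addnn leq_addr.
Qed.

Lemma code_gt0 s : (0 < CodeSeq.code s) = (0 < size s).
Proof. by case: s => //= n s; rewrite muln_gt0 expn_gt0. Qed.

(** Positivity of [code_drop i c] means that [i] is a position of the list, so default values of
    [nth] are never taken for members. *)
Lemma has_decode c (Q : pred nat) : has Q (CodeSeq.decode c) =
  bounded_ex c (fun i => (0 < code_drop i c) && Q (nth 0 (CodeSeq.decode c) i)).
Proof.
set s := CodeSeq.decode c.
apply/(has_nthP 0)/bounded_exP => -[i lti Qi]; exists i.
- exact: leq_trans lti (size_decode c).
- by rewrite code_gt0 size_drop subn_gt0 lti.
- by case/andP: Qi; rewrite code_gt0 size_drop subn_gt0.
- by case/andP: Qi.
Qed.

(** The list is read again under the bound index, which occupies variable 0; hence the hypothesis on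
    [F] in the shifted environment. *)
Lemma computable_has_decode F (Q : nat -> (nat -> nat) -> bool) :
  computable F -> computable (fun v => F (fun k => v k.+1)) ->
  computable (fun v =>
    Q (nth 0 (CodeSeq.decode (F (fun k => v k.+1))) (v 0)) (fun k => v k.+1)) ->
  computable (fun v => has (fun y => Q y v) (CodeSeq.decode (F v))).
Proof.
move=> cF cF1 cQ.
apply: computable_ext (fun v => esym (congr1 nat_of_bool (has_decode _ _))) _.
apply: computable_bounded_ex => //; apply: computable_and => //.
apply: computable_leq (computable_const 1) _.
exact: computable_code_drop (computable_var 0) cF1.
Qed.

(** * Synchronised steps, runs and projections *)

Definition exb (Q : bool -> bool) := Q true || Q false.

Lemma exbP (Q : bool -> bool) : reflect (exists b, Q b) (exb Q).
Proof.
apply: (iffP orP) => [[]|[[] Qb]];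
  [by exists true | by exists false | by left | by right].
Qed.

Lemma computable_exb (Q : bool -> (nat -> nat) -> bool) :
  computable (Q true) -> computable (Q false) ->
  computable (fun v => exb (fun b => Q b v)).
Proof. exact: computable_or. Qed.

(** Generic in states and letters, so that one formula serves both for the automaton and for its
    code. The booleans tell which of the three copies move. *)
Definition sync_step (L : Type) (S : eqType) (mv : S -> L -> S -> bool)
    (iA iB : pred L) (ls : seq L) (q p1 p2 q' p1' p2' : S) : bool :=
  has (fun l => exb (fun b => exb (fun b1 => exb (fun b2 =>
    [&& if b then mv q l q' else q == q',
        if b1 then mv p1 l p1' else p1 == p1',
        if b2 then mv p2 l p2' else p2 == p2',
        iA l ==> (b == b1) & iB l ==> (b == b2)])))) ls.

Section Product.
Variables (P M : eqType) (A : fsa (interaction P M)).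
Implicit Types (q p : state A) (s w : seq (interaction P M)) (l a : interaction P M).

Definition moves q l q' := (q, l, q') \in trans A.

Definition enabled q l := has (fun t => (t.1.1 == q) && (t.1.2 == l)) (trans A).

Lemma enabledP q l : reflect (exists q', moves q l q') (enabled q l).
Proof.
apply: (iffP hasP) => [[[[q1 l1] q'] tr /= /andP[/eqP <- /eqP <-]]|[q' tr]].
  by exists q'.
by exists (q, l, q'); rewrite //= !eqxx.
Qed.

Definition involves (X : P) l := (X == sender l) || (X == receiver l).

Lemma involvesE X l : involves X l = isSome (proj_letter X l).
Proof. by rewrite /involves /proj_letter; case: ifP => //= _; case: ifP. Qed.

Lemma interaction_eq l l' :
  sender l = sender l' -> receiver l = receiver l' -> message l = message l' -> l = l'.
Proof.
case: l l' => [[[? ?] ?] ?] [[[? ?] ?] ?]; rewrite /sender /receiver /message /=.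
by move=> es er em; apply: val_inj; rewrite /= es er em.
Qed.

(** An action records the sender, the receiver and the message. *)
Lemma proj_letter_inj X l l' :
  involves X l -> proj_letter X l = proj_letter X l' -> l = l'.
Proof.
rewrite involvesE /proj_letter.
by do ![case: ifP => _ //=] => _ [? ? ?]; apply: interaction_eq.
Qed.

Lemma proj_cons X l s :
  proj X (l :: s) = if proj_letter X l is Some x then x :: proj X s else proj X s.
Proof. by rewrite /proj /=; case: (proj_letter X l). Qed.

Fixpoint run q s q' : Prop :=
  if s is l :: s' then exists2 q1, moves q l q1 & run q1 s' q' else q = q'.

Lemma finite_pathP q s : finite_path q s <-> exists q', run q s q'.
Proof.
elim: s q => [|l s IHs] q /=; first by split=> // _; exists q.
split=> [[q1 tr /IHs[q' r]]|[q' [q1 tr r]]]; first by exists q', q1.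
by exists q1 => //; apply/IHs; exists q'.
Qed.

Lemma run_cat q s s' q' : run q (s ++ s') q' <-> exists2 q1, run q s q1 & run q1 s' q'.
Proof.
elim: s q => [|l s IHs] q /=; first by split=> [|[_ -> //]]; exists q.
split=> [[q1 tr /IHs[q2 r r']]|[q2 [q1 tr r] r']]; first by exists q2 => //; exists q1.
by exists q1 => //; apply/IHs; exists q2.
Qed.

Lemma finite_path_rcons q s a :
  finite_path q (rcons s a) <-> exists2 q', run q s q' & enabled q' a.
Proof.
split=> [/finite_pathP[q'] | [q' r /enabledP[q1 tr]]]; last first.
  apply/finite_pathP; exists q1; rewrite -cats1; apply/run_cat.
  by exists q' => //=; exists q1.
rewrite -cats1 => /run_cat[q1 r /= [q2 tr _]]; exists q1 => //.
by apply/enabledP; exists q2.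
Qed.

Hypothesis detA : deterministic A.

Lemma run_inj q s q1 q2 : run q s q1 -> run q s q2 -> q1 = q2.
Proof.
elim: s q => [|l s IHs] q /=; first by move=> -> ->.
by move=> [q3 tr3 r1] [q4 tr4]; rewrite -(detA tr3 tr4); apply: IHs.
Qed.

(** * Reachability in the product and words with equal projections *)

Definition config : finType := (state A * state A * state A)%type.

Definition sync (X Y : P) : rel config := fun c c' =>
  sync_step moves (involves X) (involves Y) (labels A)
    c.1.1 c.1.2 c.2 c'.1.1 c'.1.2 c'.2.

Lemma moves_label q l q' : moves q l q' -> l \in labels A.
Proof. by move=> tr; have /allP/(_ _ tr) := trans_labels A. Qed.

Lemma proj_rcons X s l : proj X (rcons s l) =
  proj X s ++ (if proj_letter X l is Some x then [:: x] else [::]).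
Proof. by rewrite /proj -cats1 pmap_cat /=; case: (proj_letter X l). Qed.

Lemma run_rcons q s l q1 q' : run q s q1 -> moves q1 l q' -> run q (rcons s l) q'.
Proof. by move=> r tr; rewrite -cats1; apply/run_cat; exists q1 => //=; exists q'. Qed.

(** Induction on the path from its end: the letter of the last step is appended to the words of the
    copies that move. A letter involving [X] goes to both [w] and [w1] or to neither, and other
    letters do not change projections on [X]; likewise for [Y] and [w2]. *)
Lemma sync_connect_run X Y (i : state A) c : connect (sync X Y) (i, i, i) c ->
  exists w w1 w2, [/\ run i w c.1.1, run i w1 c.1.2, run i w2 c.2,
    proj X w = proj X w1 & proj Y w = proj Y w2].
Proof.
case/connectP=> p; elim/last_ind: p c => [|p c' IHp] c /=.
  by move=> _ ->; exists [::], [::], [::].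
rewrite rcons_path last_rcons => /andP[pth st] ->{c}.
have [w [w1 [w2 [r r1 r2 eX eY]]]] := IHp _ pth erefl.
move: (last _ p) c' st r r1 r2 => [[q p1] p2] [[q' p1'] p2'].
case/hasP=> l _ /exbP[b /exbP[b1 /exbP[b2 /and5P[/= mq m1 m2 iX iY]]]] r r1 r2.
pose ext (b : bool) s := if b then rcons s l else s.
have run_ext d x y s : run i s x -> (if d then moves x l y else x == y) ->
    run i (ext d s) y.
  by case: d => [|+ /eqP <- //]; apply: run_rcons.
have proj_ext Z d d' s s' : proj Z s = proj Z s' -> involves Z l ==> (d == d') ->
    proj Z (ext d s) = proj Z (ext d' s').
  rewrite involvesE; case: d d' => [] [] //= es; rewrite ?proj_rcons ?es //.
    by case: (proj_letter Z l) => //=; rewrite cats0.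
  by case: (proj_letter Z l) => //=; rewrite cats0.
exists (ext b w), (ext b1 w1), (ext b2 w2).
split; [exact: run_ext r mq | exact: run_ext r1 m1 | exact: run_ext r2 m2 | |].
  exact: proj_ext.
exact: proj_ext.
Qed.

(** Induction on the total length of the words. A head of [w1] not involving [X], or of [w2] not
    involving [Y], is read by that copy alone; otherwise the head of [w] is read, jointly with the
    copies that must synchronise on it. *)
Lemma run_sync_connect X Y (q p1 p2 q' p1' p2' : state A) w w1 w2 :
  run q w q' -> run p1 w1 p1' -> run p2 w2 p2' ->
  proj X w = proj X w1 -> proj Y w = proj Y w2 ->
  connect (sync X Y) (q, p1, p2) (q', p1', p2').
Proof.
have step l b b1 b2 x y1 y2 x' y1' y2' : l \in labels A ->
    (if b then moves x l x' else x == x') ->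
    (if b1 then moves y1 l y1' else y1 == y1') ->
    (if b2 then moves y2 l y2' else y2 == y2') ->
    involves X l ==> (b == b1) -> involves Y l ==> (b == b2) ->
    connect (sync X Y) (x', y1', y2') (q', p1', p2') ->
    connect (sync X Y) (x, y1, y2) (q', p1', p2').
  move=> ll mq m1 m2 iX iY; apply: connect_trans; apply: connect1.
  apply/hasP; exists l => //; apply/exbP; exists b; apply/exbP; exists b1.
  by apply/exbP; exists b2; apply/and5P.
have [n] := ubnP (size w + size w1 + size w2).
elim: n w w1 w2 q p1 p2 => // n IHn w w1 w2 q p1 p2 ltn r r1 r2 eX eY.
(* The second alternative says that [w1] is empty or begins with a letter involving [X]. *)
have [[l [s1 [ew1 iX]]]|w1P] : (exists l s1, w1 = l :: s1 /\ ~~ involves X l) \/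
    all (involves X) (take 1 w1).
- case: (w1) => [|l s1]; first by right.
  by case: (boolP (involves X l)) => iX; [right; rewrite /= take0 iX | left; exists l, s1].
- subst w1; case: r1 => x tr r1; apply: (step l false true false q p1 p2 q x p2) => //.
  + exact: moves_label tr.
  + by rewrite implybT.
  apply: (IHn w s1 w2) => //; first by move: ltn; rewrite /= !addnS addSn ltnS.
  by move: eX iX; rewrite proj_cons involvesE; case: (proj_letter X l).
have [[l [s2 [ew2 iY]]]|w2P] : (exists l s2, w2 = l :: s2 /\ ~~ involves Y l) \/
    all (involves Y) (take 1 w2).
- case: (w2) => [|l s2]; first by right.
  by case: (boolP (involves Y l)) => iY; [right; rewrite /= take0 iY | left; exists l, s2].
- subst w2; case: r2 => x tr r2; apply: (step l false false true q p1 p2 q p1 x) => //.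
  + exact: moves_label tr.
  + by rewrite implybT.
  apply: (IHn w w1 s2) => //; first by move: ltn; rewrite /= !addnS ltnS.
  by move: eY iY; rewrite proj_cons involvesE; case: (proj_letter Y l).
(* If [w] is empty, so are both projections, and then [w1] and [w2] are empty because their heads
   would be visible. *)
case: w r eX eY ltn => [|l w] r eX eY ltn.
  case: w1 r1 eX w1P {ltn} => [|l w1] r1 eX; last first.
    rewrite /= take0 andbT involvesE; move: eX.
    by rewrite proj_cons; case: (proj_letter X l).
  case: w2 r2 eY w2P => [|l w2] r2 eY; last first.
    rewrite /= take0 andbT involvesE; move: eY.
    by rewrite proj_cons; case: (proj_letter Y l).
  by move=> _ _; move: r r1 r2 => /= <- <- <-.
case: r => x tr r; have ll := moves_label tr.
(* A participant of [l] must find [l] as the head of its own copy. *)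
have head Z u y y' : run y u y' -> proj Z (l :: w) = proj Z u ->
    all (involves Z) (take 1 u) ->
  exists y1 u', [/\ if involves Z l then moves y l y1 else y == y1,
    run y1 u' y', proj Z w = proj Z u' & size u' <= size u].
  case: (boolP (involves Z l)) => iZ ru eu hu; last first.
    exists y, u; split=> //; move: eu iZ; rewrite proj_cons involvesE.
    by case: (proj_letter Z l).
  case: u ru eu hu => [|l' u] ru eu; rewrite /= ?take0 ?andbT => hu.
    by move: eu iZ; rewrite proj_cons involvesE; case: (proj_letter Z l).
  have el : l = l'.
    apply: (proj_letter_inj iZ); move: eu iZ hu; rewrite !proj_cons !involvesE.
    by case: (proj_letter Z l) (proj_letter Z l') => [?|] [?|] //= [-> _].
  subst l'; case: ru => y1 tr1 ru; exists y1, u; split=> //.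
  by move: eu iZ; rewrite !proj_cons involvesE; case: (proj_letter Z l) => [?|] //= [].
have [y1 [u1 [m1 ru1 e1 s1]]] := head X _ _ _ r1 eX w1P.
have [y2 [u2 [m2 ru2 e2 s2]]] := head Y _ _ _ r2 eY w2P.
apply: (step l true _ _ _ _ _ _ _ _ ll tr m1 m2).
- by case: involves.
- by case: involves.
apply: (IHn w u1 u2) => //; rewrite /= !addSn ltnS in ltn.
by apply: leq_ltn_trans ltn; rewrite !leq_add.
Qed.

(** * CUI as the absence of reachable violations *)

Definition CUI_violation a :=
  [exists c : config, connect (sync (sender a) (receiver a)) (init A, init A, init A) c &&
    [&& ~~ enabled c.1.1 a, enabled c.1.2 a & enabled c.2 a]].

Lemma CUI_violationP : CUI (lang A) <-> ~~ has CUI_violation (labels A).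
Proof.
split=> [cui|noV w1 w2 a].
  apply/hasPn => a al; apply/existsP => -[c /andP[/sync_connect_run]].
  move=> [w [w1 [w2 [r r1 r2 eX eY]]]] /and3P[/negP nE E1 E2]; apply: nE.
  have Kw1 : lang A (Fin (rcons w1 a)) by apply/finite_path_rcons; exists c.1.2.
  have Kw2 : lang A (Fin (rcons w2 a)) by apply/finite_path_rcons; exists c.2.
  have Kw : lang A (Fin w) by apply/finite_pathP; exists c.1.1.
  have /finite_path_rcons[q r' E] := cui _ _ _ Kw1 Kw2 _ Kw eX eY.
  (* By determinism the run of [w] can only end in [c.1.1]. *)
  by rewrite (run_inj r r').
move=> /finite_path_rcons[p1 r1 E1] /finite_path_rcons[p2 r2 E2] [w|f] //=.
move=> /finite_pathP[q r] eX eY; apply/finite_path_rcons; exists q => //.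
apply/negPn/negP => nE; case/negP: noV; apply/hasP; exists a.
  by have /enabledP[p1'] := E1; apply: moves_label.
apply/existsP; exists (q, p1, p2); rewrite /= E1 E2 nE !andbT.
exact: (run_sync_connect r r1 r2 eX eY).
Qed.

End Product.

(** * Paths of fixed length and digits in a base *)

Lemma connect_bounded (T : finType) (e : rel T) (k : nat) (x y : T) :
  reflexive e -> #|T| <= k ->
  connect e x y <-> exists r : nat -> T,
    [/\ r 0 = x, r k = y & forall i, i < k -> e (r i) (r i.+1)].
Proof.
move=> er lek; split=> [/connectP[p0 pth0 ->{y}]|[r [<- <- st]]]; last first.
  elim: {lek} k st => [_|k IHk st]; first exact: connect0.
  by apply: connect_trans (IHk _) (connect1 (st k _)) => // i lti; apply/st/ltnW.
case/shortenP: pth0 => p pth up _; pose y := last x p.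
have ltp : size p < k.
  by have := max_card (mem (x :: p)); rewrite (card_uniqP up) => /leq_trans; apply.
(* The repetition-free path has fewer than [k] steps; afterwards the sequence stays at the default
   [y], and reflexivity supplies the idle steps. *)
exists (nth y (x :: p)); split=> // [|i _].
  by rewrite nth_default // ltnW.
case: (ltnP i (size p)) => [lti|]; first by have /(pathP y) := pth; apply.
rewrite leq_eqVlt => /orP[/eqP <-|lti]; last by rewrite !nth_default // ltnW.
by rewrite nth_last nth_default.
Qed.

Definition digit (b c i : nat) := c %/ b ^ i %% b.

(** As in Horner's scheme, [d 0] is put below the number found for the shifted sequence. Quantifying
    over sequences thus becomes bounded quantification over numbers. *)
Lemma digits_exist b k (d : nat -> nat) : (forall i, d i < b) ->
  exists2 c, c < b ^ k & forall i, i < k -> digit b c i = d i.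
Proof.
elim: k d => [|k IHk] d ltd; first by exists 0.
have [c ltc cd] := IHk (fun i => d i.+1) (fun i => ltd i.+1).
exists (d 0 + c * b) => [|[|i] lti].
- by rewrite expnSr (leq_trans _ (leq_mul ltc (leqnn b))) // mulSn ltn_add2r.
- by rewrite /digit divn1 addnC modnMDl modn_small.
- have b_gt0 := leq_ltn_trans (leq0n _) (ltd 0).
  by rewrite /digit expnS divnMA addnC divnMDl // (divn_small (ltd 0)) addn0 -cd.
Qed.

(** * The decision procedure on codes *)

Local Notation fld := (fun c i => nth 0 (CodeSeq.decode c) i).

Definition code_moves (ct q l q' : nat) :=
  has (fun t => [&& fld t 0 == q, fld t 1 == l & fld t 2 == q']) (CodeSeq.decode ct).

Definition code_enabled (ct q l : nat) :=
  has (fun t => (fld t 0 == q) && (fld t 1 == l)) (CodeSeq.decode ct).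

Definition code_involves (X l : nat) := (X == fld l 0) || (X == fld l 1).

(* A path of N ^ 3 steps in the product is given by three numbers whose base N
   digits are the states of the three copies. *)
Definition code_violation (n q0 cl ct a : nat) :=
  let b := n ^ (n ^ 3).+1 in
  bounded_ex b (fun c => bounded_ex b (fun c1 => bounded_ex b (fun c2 =>
    [&& [&& digit n c 0 == q0, digit n c1 0 == q0 & digit n c2 0 == q0],
        bounded_all (n ^ 3) (fun i =>
          sync_step (code_moves ct) (code_involves (fld a 0))
            (code_involves (fld a 1)) (CodeSeq.decode cl)
            (digit n c i) (digit n c1 i) (digit n c2 i)
            (digit n c i.+1) (digit n c1 i.+1) (digit n c2 i.+1)) &
        [&& ~~ code_enabled ct (digit n c (n ^ 3)) a,
            code_enabled ct (digit n c1 (n ^ 3)) a &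
            code_enabled ct (digit n c2 (n ^ 3)) a]]))).

Definition code_CUI (x : nat) : bool :=
  ~~ has (code_violation (fld x 0) (fld x 1) (fld x 2) (fld x 3))
         (CodeSeq.decode (fld x 2)).

(** The reduction resolves each [if] on a boolean fixed by [computable_exb]; comparisons of two such
    booleans are then constants. *)
Ltac prove_computable := repeat (cbv beta iota; first
  [ exact: computable_var | exact: computable_const
  | apply: computable_nth_decode | apply: computable_eq | apply: computable_and
  | apply: computable_exb | apply: computable_has_decode
  | apply: computable_or | apply: computable_imp
  | apply: computable_neg | apply: computable_bounded_ex
  | apply: computable_bounded_all
  | apply: computable_mod | apply: computable_div | apply: computable_exp
  | apply: computable_succ]).

Lemma computable_code_CUI : computable (fun v => code_CUI (v 0)).
Proof.
rewrite /code_CUI /code_violation /sync_step /code_moves /code_enabled.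
rewrite /code_involves /digit.
prove_computable.
Qed.

(** * Agreement of the coded test with the automaton *)

Section Correctness.
Variables (P M : eqType) (A : fsa (interaction P M)) (nP : P -> nat) (nM : M -> nat).
Hypothesis nP_inj : {in participants A &, injective nP}.
Hypothesis nM_inj : {in messages A &, injective nM}.

Local Notation ci := (code_interaction nP nM).
Local Notation ct := (CodeSeq.code (map (@code_trans P M nP nM (state A)) (trans A))).
Local Notation cl := (CodeSeq.code (map ci (labels A))).

Lemma sender_participant l : l \in labels A -> sender l \in participants A.
Proof. by move=> ll; rewrite mem_cat map_f. Qed.

Lemma receiver_participant l : l \in labels A -> receiver l \in participants A.
Proof. by move=> ll; rewrite mem_cat map_f ?orbT. Qed.

(** The numberings are injective only on what occurs in [A], which is why the lemmas below are
    restricted to its labels and participants. *)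
Lemma code_interaction_inj : {in labels A &, injective ci}.
Proof.
move=> l l' ll ll' /(can_inj CodeSeq.codeK)[].
move=> /nP_inj-/(_ (sender_participant ll) (sender_participant ll')) es.
move=> /nP_inj-/(_ (receiver_participant ll) (receiver_participant ll')) er.
move=> /nM_inj-/(_ (map_f _ ll) (map_f _ ll')) em.
exact: interaction_eq.
Qed.

Lemma code_state_eq (q q' : state A) : (code_state q == code_state q') = (q == q').
Proof. by rewrite (inj_eq val_inj) (inj_eq enum_rank_inj). Qed.

Lemma code_movesE (q : state A) l q' : l \in labels A ->
  code_moves ct (code_state q) (ci l) (code_state q') = moves q l q'.
Proof.
move=> ll; rewrite /code_moves CodeSeq.codeK has_map; apply/hasP/idP => [|tr].
  case=> -[[q1 l1] q1'] tr; rewrite /= CodeSeq.codeK /= !code_state_eq.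
  case/and3P=> /eqP eq /eqP el /eqP eq'; rewrite /moves -eq -eq'.
  by rewrite -(code_interaction_inj (moves_label tr) ll el).
by exists (q, l, q'); rewrite //= CodeSeq.codeK /= !eqxx.
Qed.

Lemma code_enabledE (q : state A) l : l \in labels A ->
  code_enabled ct (code_state q) (ci l) = enabled q l.
Proof.
move=> ll; rewrite /code_enabled CodeSeq.codeK has_map; apply: eq_in_has.
case=> -[q1 l1] q1' tr; rewrite /= CodeSeq.codeK /= code_state_eq.
by rewrite (inj_in_eq code_interaction_inj (moves_label tr) ll).
Qed.

Lemma code_involvesE X l : X \in participants A -> l \in labels A ->
  code_involves (nP X) (ci l) = involves X l.
Proof.
move=> pX ll; rewrite /code_involves CodeSeq.codeK /=.
by rewrite !(inj_in_eq nP_inj pX) ?sender_participant ?receiver_participant.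
Qed.

Lemma code_sync_step X Y (q p1 p2 q' p1' p2' : state A) :
  X \in participants A -> Y \in participants A ->
  sync_step (code_moves ct) (code_involves (nP X)) (code_involves (nP Y))
    (CodeSeq.decode cl) (code_state q) (code_state p1) (code_state p2)
    (code_state q') (code_state p1') (code_state p2')
  = sync X Y (q, p1, p2) (q', p1', p2').
Proof.
move=> pX pY; rewrite /sync /sync_step /= CodeSeq.codeK has_map; apply: eq_in_has => l ll.
rewrite /exb /preim /= !code_movesE // !code_involvesE //.
by rewrite !code_state_eq.
Qed.

(** An idle step still has to name a label, which no copy reads. *)
Lemma sync_refl X Y l : l \in labels A -> reflexive (@sync P M A X Y).
Proof.
move=> ll c; apply/hasP; exists l => //; apply/exbP; exists false; apply/exbP.
by exists false; apply/exbP; exists false; rewrite !eqxx !implybT.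
Qed.

Lemma ltn_code_state (q : state A) : code_state q < #|state A|.
Proof. exact: ltn_ord. Qed.

Lemma card_config : #|config A| = #|state A| ^ 3.
Proof. by rewrite !card_prod !expnS expn0 muln1 mulnA. Qed.

Lemma code_violationE a : a \in labels A ->
  code_violation #|state A| (code_state (init A)) cl ct (ci a) = CUI_violation A a.
Proof.
move=> al; rewrite /code_violation.
set n := #|state A|; set k := n ^ 3.
have pS := sender_participant al; have pR := receiver_participant al.
have [f0 f1] : nth 0 (CodeSeq.decode (ci a)) 0 = nP (sender a) /\
    nth 0 (CodeSeq.decode (ci a)) 1 = nP (receiver a).
  by rewrite CodeSeq.codeK.
rewrite f0 f1.
have conn c := @connect_bounded (config A) (sync (sender a) (receiver a)) k
  (init A, init A, init A) c (sync_refl _ _ al) (eq_leq card_config).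
apply/idP/existsP.
  case/bounded_exP=> c _ /bounded_exP[c1 _ /bounded_exP[c2 _]].
  (* Any number describes a sequence of states, since its base [n] digits are below [n], and [n] is
     positive because of [init A]. *)
  have st d : exists r : nat -> state A, forall i, code_state (r i) = digit n d i.
    have n_gt0 : 0 < n by apply/card_gt0P; exists (init A).
    have ltd i : digit n d i < n by rewrite ltn_mod.
    by exists (fun i => enum_val (Ordinal (ltd i))) => i; rewrite /code_state enum_valK.
  have [[r rE] [r1 r1E] [r2 r2E]] := And3 (st c) (st c1) (st c2).
  rewrite -!rE -!r1E -!r2E !code_state_eq !code_enabledE //.
  case/and3P=> /and3P[/eqP e /eqP e1 /eqP e2] /bounded_allP pth E.
  exists (r k, r1 k, r2 k); rewrite E andbT; apply/conn.
  exists (fun i => (r i, r1 i, r2 i)); split; rewrite ?e ?e1 ?e2 // => i lti.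
  by rewrite -code_sync_step // !rE !r1E !r2E pth.
case=> c /andP[/conn[r [r0 rk st]] E].
have dig (g : config A -> state A) : exists2 d, d < n ^ k.+1 &
    forall i, i <= k -> digit n d i = code_state (g (r i)).
  (* A path with [k] steps visits [k.+1] configurations, hence the number of digits. *)
  have [d ltd dE] := digits_exist k.+1 (fun i => ltn_code_state (g (r i))).
  by exists d.
have [d ltd dE] := dig (fun c => c.1.1).
have [d1 ltd1 dE1] := dig (fun c => c.1.2).
have [d2 ltd2 dE2] := dig (fun c => c.2).
apply/bounded_exP; exists d => //; apply/bounded_exP; exists d1 => //.
apply/bounded_exP; exists d2 => //.
rewrite !dE // !dE1 // !dE2 // r0 rk !eqxx !code_enabledE // E !andbT /=.
apply/bounded_allP => i lti.
rewrite !dE ?(ltnW lti) // !dE1 ?(ltnW lti) // !dE2 ?(ltnW lti) //.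
rewrite code_sync_step //; have := st i lti.
by case: (r i) (r i.+1) => [[? ?] ?] [[? ?] ?].
Qed.

Lemma code_CUIP : deterministic A -> code_CUI (code_fsa nP nM A) <-> CUI (lang A).
Proof.
move=> detA; apply: iff_trans (iff_sym (CUI_violationP detA)).
suff -> : code_CUI (code_fsa nP nM A) = ~~ has (CUI_violation A) (labels A) by [].
rewrite /code_CUI /code_fsa CodeSeq.codeK /=; congr (~~ _).
rewrite [X in has _ X]CodeSeq.codeK has_map.
by apply: eq_in_has => a al; apply: code_violationE.
Qed.

End Correctness.

(* The sets of participants and messages are arbitrary, so a c-automaton is
   given to the algorithm through any numbering of the participants and of the
   messages that is injective on those occurring in its labels. *)
Theorem theorem7p5 (P M : eqType) :
  exists decider : recfun 1,
    forall A : fsa (interaction P M), deterministic A ->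
    forall (nP : P -> nat) (nM : M -> nat),
      {in participants A &, injective nP} ->
      {in messages A &, injective nM} ->
      answers decider (code_fsa nP nM A) (CUI (lang A)).
Proof.
(* The program comes from [code_CUI] alone, before any automaton or numbering is given. *)
have [f fP] := computable_code_CUI 1; exists f => A detA nP nM nP_inj nM_inj.
exists (code_CUI (code_fsa nP nM A)); split; first exact: fP.
exact: code_CUIP.
Qed.
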